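(* The invariant $\mathrm{secat}^{\mathrm{WG}}$, defined for maps in $\mathcal{T}$, satisfies the following three axioms. S0. For any map $\iota\colon A\to Y$ in $\mathcal{T}$, $\mathrm{secat}^{\mathrm{WG}}(\iota)=0$ if and only if $\iota$ has a homotopy section, i.e. there is a map $s\colon Y\to A$ with $\iota\circ s\simeq \mathrm{id}_Y$. S1. For any maps $\kappa\colon B\to X$, $\iota\colon A\to X$ and $\zeta\colon B\to A$ in $\mathcal{T}$ with $\iota\circ\zeta\simeq\kappa$, one has $\mathrm{secat}^{\mathrm{WG}}(\iota)\leq \mathrm{secat}^{\mathrm{WG}}(\kappa)$. S2. For any homotopy pullback square in $\mathcal{T}$ formed by $p\colon P\to A$, $q\colon P\to X$, $\iota\colon A\to Y$, $f\colon X\to Y$ (with $\iota\circ p\simeq f\circ q$), one has $\mathrm{secat}^{\mathrm{WG}}(q)\leq\mathrm{secat}^{\mathrm{WG}}(\iota)$.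
   Context: $\mathcal{T}$ denotes either $\mathbf{Top}$ (topological spaces, continuous maps, free homotopies) or $\mathbf{Top}^w$ (well-pointed spaces, i.e. the inclusion of the basepoint is a closed cofibration; basepoint-preserving continuous maps; pointed homotopies). Spaces are non-empty, except that the homotopy pullback $P$ of two maps in $\mathbf{Top}$ may be empty. $\simeq$ means homotopic. Homotopy pullbacks and homotopy pushouts are the usual ones (Mather), for (strong) homotopy equivalences. For $\iota\colon A\to Y$, define maps $t_i\colon T^i(\iota)\to Y^{i+1}$ inductively: $T^0(\iota)=A$, $t_0=\iota$; for $i>0$, $T^i(\iota)$ is the homotopy pushout of $$Y^i\times A \xleftarrow{\;t_{i-1}\times \mathrm{id}_A\;} T^{i-1}(\iota)\times A \xrightarrow{\;\mathrm{id}\times\iota\;} T^{i-1}(\iota)\times Y,$$ and $t_i\colon T^i(\iota)\to Y^{i+1}$ is the map induced by this homotopy pushout from $\mathrm{id}_{Y^i}\times\iota\colon Y^i\times A\to Y^{i+1}$ and $t_{i-1}\times \mathrm{id}_Y\colon T^{i-1}(\iota)\times Y\to Y^{i+1}$ (which agree on $T^{i-1}(\iota)\times A$). Then $\mathrm{secat}^{\mathrm{WG}}(\iota)$ is the least integer $n$ such that there is a map $l\colon Y\to T^n(\iota)$ with $t_n\circ l\simeq \Delta_{n+1}$, where $\Delta_{n+1}\colon Y\to Y^{n+1}$ is the diagonal map; it is $\infty$ if no such $n$ exists. *)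

(* Defs.v *)
From mathcomp Require Import all_boot all_order all_algebra generic_quotient.
From mathcomp Require Import all_classical all_reals all_analysis.
From Stdlib Require Import Relation_Operators.

Set Implicit Arguments.
Unset Strict Implicit.
Unset Printing Implicit Defensive.

Import Order.TTheory GRing.Theory Num.Theory.
Import numFieldNormedType.Exports.

Local Open Scope classical_set_scope.
Local Open Scope quotient_scope.
Local Open Scope ring_scope.

(* [Top] is the category of spaces and free homotopies, [TopW] that of
   well-pointed spaces and pointed homotopies.  Both are treated at once by
   equipping a space with an optional base point: [None] throughout for [Top],
   [Some x0] for [TopW]. *)
Inductive setting := Top | TopW.

Record bspace := BSpace {
  carrier :> topologicalType;
  basept : option carrier }.

(* Vacuous when neither [X] nor [Y] has a base point. *)
Definition based (X Y : bspace) (f : X -> Y) : Prop :=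
  omap f (basept X) = basept Y.

Definition is_map (X Y : bspace) (f : X -> Y) : Prop :=
  continuous f /\ based f.

Definition bprod (X Y : bspace) : bspace :=
  @BSpace (X * Y)%type
    (obind (fun x => omap (fun y => (x, y)) (basept Y)) (basept X)).

Definition prod_map (X X' Y Y' : Type) (f : X -> X') (g : Y -> Y')
  (z : X * Y) : X' * Y' := (f z.1, g z.2).

Section Homotopy.
Variable R : realType.

Definition unit_interval : set R := [set t | 0 <= t <= 1].

(* The topology on [uI] is the subspace topology induced by [R]. *)
Definition uI : topologicalType := set_type unit_interval.

Lemma I0_subproof : (0 : R) \in unit_interval.
Proof. by rewrite inE /unit_interval /= lexx ler01. Qed.

Lemma I1_subproof : (1 : R) \in unit_interval.
Proof. by rewrite inE /unit_interval /= ler01 lexx. Qed.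

Definition uI0 : uI := exist _ 0 I0_subproof.
Definition uI1 : uI := exist _ 1 I1_subproof.

Definition closed_cofibration (X : topologicalType) (A : set X) : Prop :=
  closed A /\
  forall (Z : topologicalType) (f : X -> Z) (h : A * uI -> Z),
    continuous f -> continuous h -> (forall a, h (a, uI0) = f (set_val a)) ->
    exists H : X * uI -> Z,
      [/\ continuous H, forall x, H (x, uI0) = f x &
          forall a t, H (set_val a, t) = h (a, t)].

Definition well_pointed (X : topologicalType) (x0 : X) : Prop :=
  closed_cofibration [set x0].

(* Objects of the category, except that the empty space is allowed in [Top]. *)
Definition possibly_empty_object (T : setting) (X : bspace) : Prop :=
  match T with
  | Top => basept X = None
  | TopW => exists2 x0 : X, basept X = Some x0 & well_pointed x0
  end.

Definition object (T : setting) (X : bspace) : Prop :=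
  possibly_empty_object T X /\ inhabited X.

Definition is_homotopy (X Y : bspace) (H : X * uI -> Y) (f g : X -> Y) : Prop :=
  [/\ continuous H, forall t, based (fun x => H (x, t)),
      forall x, H (x, uI0) = f x & forall x, H (x, uI1) = g x].

Definition homotopic (X Y : bspace) (f g : X -> Y) : Prop :=
  exists H : X * uI -> Y, is_homotopy H f g.

Definition homotopy_equivalence (X Y : bspace) (f : X -> Y) : Prop :=
  is_map f /\
  exists g : Y -> X, [/\ is_map g, homotopic (g \o f) idfun &
                         homotopic (f \o g) idfun].

Section HomotopyPullback.
Variables (A X Y : bspace) (u : A -> Y) (v : X -> Y).

(* Standard homotopy pullback: triples (a, gamma, x) where gamma is a path
   from u a to v x. *)
Definition hpb_set : set (A * {compact-open, uI -> Y} * X) :=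
  [set z | [/\ continuous (z.1.2 : uI -> Y), z.1.2 uI0 = u z.1.1 &
               z.1.2 uI1 = v z.2]].

(* When the three spaces have base points respected by [u] and [v], the base
   point is (a0, constant path, x0); otherwise there is none. *)
Definition hpb : bspace :=
  @BSpace (set_type hpb_set)
    match basept A, basept Y, basept X with
    | Some a0, Some y0, Some x0 =>
        insub (a0, (fun=> y0) : {compact-open, uI -> Y}, x0)
    | _, _, _ => None
    end.

End HomotopyPullback.

(* The square with sides p, q, u, v is a homotopy pullback if, for some homotopy
   u \o p ~ v \o q, the whisker map to the standard homotopy pullback is a
   homotopy equivalence. *)
Definition homotopy_pullback (P A X Y : bspace)
    (p : P -> A) (q : P -> X) (u : A -> Y) (v : X -> Y) : Prop :=
  exists H : P * uI -> Y,
    is_homotopy H (u \o p) (v \o q) /\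
    exists w : P -> hpb u v,
      (forall z, set_val (w z) = (p z, (fun t => H (z, t)), q z)) /\
      homotopy_equivalence w.

Section HomotopyPushout.
Variables (A B C : bspace) (f : C -> A) (g : C -> B).

(* Disjoint union of A, C * uI and B. *)
Definition dmc_part (k : option bool) : topologicalType :=
  match k with
  | None => (C * uI)%type
  | Some false => A
  | Some true => B
  end.

Definition dmc_pre : Type := {k : option bool & dmc_part k}.
Definition pre_l (a : A) : dmc_pre := existT dmc_part (Some false) a.
Definition pre_r (b : B) : dmc_pre := existT dmc_part (Some true) b.
Definition pre_cyl (z : C * uI) : dmc_pre := existT dmc_part None z.

Inductive dmc_glue : dmc_pre -> dmc_pre -> Prop :=
| glue_l c : dmc_glue (pre_cyl (c, uI0)) (pre_l (f c))
| glue_r c : dmc_glue (pre_cyl (c, uI1)) (pre_r (g c))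
| glue_base c0 t : basept C = Some c0 ->
    dmc_glue (pre_cyl (c0, t)) (pre_cyl (c0, uI0)).

Definition dmc_rel (x y : dmc_pre) : bool :=
  `[< clos_refl_sym_trans _ dmc_glue x y >].

Lemma dmc_rel_refl : reflexive dmc_rel.
Proof. by move=> x; apply/asboolP; exact: rst_refl. Qed.

Lemma dmc_rel_sym : symmetric dmc_rel.
Proof. by move=> x y; apply/asboolP/asboolP; exact: rst_sym. Qed.

Lemma dmc_rel_trans : transitive dmc_rel.
Proof.
move=> y x z /asboolP xy /asboolP yz; apply/asboolP; exact: rst_trans xy yz.
Qed.

Definition dmc_equiv := EquivRel dmc_rel dmc_rel_refl dmc_rel_sym dmc_rel_trans.

Definition dmc_carrier : topologicalType :=
  quotient_topology {eq_quot dmc_equiv}.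

Definition dmc_pi (x : dmc_pre) : dmc_carrier := \pi_({eq_quot dmc_equiv}) x.

(* Standard homotopy pushout: the double mapping cylinder of f and g, with the
   quotient topology; it is reduced when C has a base point. *)
Definition dmc : bspace :=
  @BSpace dmc_carrier (omap (fun a => dmc_pi (pre_l a)) (basept A)).

Section Induced.
Variables (Z : Type) (u : A -> Z) (v : B -> Z).

Definition pre_induced (x : dmc_pre) : Z :=
  match x with
  | existT None z => u (f z.1)
  | existT (Some false) a => u a
  | existT (Some true) b => v b
  end.

(* The map out of [dmc] induced by u and v when u \o f = v \o g, constant along
   the segments of the cylinder; see [dmc_inducedE]. *)
Definition dmc_induced (x : dmc) : Z :=
  pre_induced (repr (x : {eq_quot dmc_equiv})).

Lemma dmc_inducedE : (forall c, u (f c) = v (g c)) ->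
  forall x, dmc_induced (dmc_pi x) = pre_induced x.
Proof.
move=> uv x; rewrite /dmc_induced /dmc_pi.
have /eqmodP/asboolP : repr (\pi_({eq_quot dmc_equiv}) x) = x
  %[mod {eq_quot dmc_equiv}] by rewrite reprK.
move: (repr _) => y; elim=> {x y} //.
- by move=> x y [].
- by move=> x y z _ -> _ ->.
Qed.

End Induced.
End HomotopyPushout.

(* [bpow Y n] is the (n+1)-fold product of Y, as (...(Y * Y) * ...) * Y. *)
Fixpoint bpow (Y : bspace) (n : nat) : bspace :=
  if n is n'.+1 then bprod (bpow Y n') Y else Y.

Fixpoint diagonal (Y : bspace) (n : nat) : Y -> bpow Y n :=
  match n return Y -> bpow Y n with
  | 0 => idfun
  | n'.+1 => fun y => (@diagonal Y n' y, y)
  end.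

Section WhiteheadGanea.
Variables (A Y : bspace) (iota : A -> Y).

(* The pair of T^n(iota) and t_n : T^n(iota) -> Y^{n+1}. *)
Fixpoint WG_stage (n : nat) : {T : bspace & T -> bpow Y n} :=
  match n return {T : bspace & T -> bpow Y n} with
  | 0 => existT _ A iota
  | n'.+1 =>
      let: existT T t := WG_stage n' in
      existT (fun T' : bspace => T' -> bpow Y n'.+1)
        (@dmc (bprod (bpow Y n') A) (bprod T Y) (bprod T A)
           (prod_map t idfun) (prod_map idfun iota))
        (@dmc_induced (bprod (bpow Y n') A) (bprod T Y) (bprod T A)
           (prod_map t idfun) (prod_map idfun iota) (bpow Y n'.+1)
           (prod_map idfun iota) (prod_map t idfun))
  end.

Definition WG_space (n : nat) : bspace := projT1 (WG_stage n).

Definition WG_map (n : nat) : WG_space n -> bpow Y n :=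
  projT2 (WG_stage n).

Definition has_WG_lift (n : nat) : Prop :=
  exists l : Y -> WG_space n,
    is_map l /\ homotopic (@WG_map n \o l) (@diagonal Y n).

Definition secatWG : \bar int :=
  match pselect (exists n, `[< has_WG_lift n >]) with
  | left ex => ((ex_minn ex)%:Z)%:E
  | right _ => +oo%E
  end.

End WhiteheadGanea.
End Homotopy.

(* Main.v *)
Require Import Defs.
From mathcomp Require Import all_boot all_order all_algebra.
From mathcomp Require Import all_classical all_reals all_analysis.
From mathcomp Require Import generic_quotient lra.
From Stdlib Require Import Relation_Operators.

(* Call a family of weights rho_0, ..., rho_n on Y a cover for iota if their
   sets of positivity cover Y and iota has, over each of them, a local section
   up to (pointed) homotopy.  For spaces in which the base point is deformable,
   a lift of the diagonal through T^n(iota) exists if and only if such a cover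
   does, and covers visibly pull back along maps and homotopy pullbacks.

   From a cover to a lift: the ratio rho_1 / (rho_1 + rho_2) serves as the
   coordinate of the double mapping cylinder.

   From a lift to a cover: the cylinder coordinate splits Y into a part mapped
   to Y^n x A and a part mapped to T^(n-1) x Y.  In the pointed case this
   coordinate is not defined at the base point of the reduced cylinder, so it is
   replaced by a continuous function sigma vanishing there, obtained by
   deforming neighbourhoods of the base points of A and Y. *)

Set Implicit Arguments.
Unset Strict Implicit.
Unset Printing Implicit Defensive.

Import Order.TTheory GRing.Theory Num.Theory.
Import numFieldNormedType.Exports.

Local Open Scope classical_set_scope.
Local Open Scope quotient_scope.
Local Open Scope ring_scope.

(** * Pointwise continuity and the unit interval *)

Section PointwiseContinuity.
Variables X Y Z : topologicalType.

(** Continuity at a single point is the basic notion because local lifts and their homotopies are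
    total functions, continuous only where some weight is positive. *)
Definition cont_at (U V : topologicalType) (f : U -> V) (x : U) : Prop :=
  {for x, continuous f}.

Lemma cont_at_comp (f : X -> Y) (g : Y -> Z) x :
  cont_at f x -> cont_at g (f x) -> cont_at (fun z => g (f z)) x.
Proof. exact: continuous_comp. Qed.

Lemma cont_at_id x : cont_at (fun z : X => z) x.
Proof. exact: cvg_id. Qed.

Lemma cont_at_cst (y : Y) (x : X) : cont_at (fun=> y) x.
Proof. exact: cvg_cst. Qed.

Lemma cont_at_pair (f : X -> Y) (g : X -> Z) x :
  cont_at f x -> cont_at g x -> cont_at (fun z => (f z, g z)) x.
Proof. exact: cvg_pair. Qed.

Lemma cont_at_fst (f : X -> Y * Z) x :
  cont_at f x -> cont_at (fun z => (f z).1) x.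
Proof. by move=> fx; apply: (cvg_comp _ _ fx); exact: cvg_fst. Qed.

Lemma cont_at_snd (f : X -> Y * Z) x :
  cont_at f x -> cont_at (fun z => (f z).2) x.
Proof. by move=> fx; apply: (cvg_comp _ _ fx); exact: cvg_snd. Qed.

Lemma cont_at_near (f g : X -> Y) x :
  (\forall z \near x, f z = g z) -> cont_at g x -> cont_at f x.
Proof.
move=> fg gx; rewrite /cont_at /prop_for /continuous_at (nbhs_singleton fg).
apply: cvg_trans gx; apply: near_eq_cvg.
by apply: filterS fg => z ->.
Qed.

Lemma cont_at_ext (f g : X -> Y) x : f =1 g -> cont_at g x -> cont_at f x.
Proof. by move=> fg; apply: cont_at_near; apply: nearW. Qed.

Lemma cont_atP (f : X -> Y) x :
  (forall V, nbhs (f x) V -> \forall z \near x, V (f z)) -> cont_at f x.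
Proof. exact. Qed.

Lemma cont_at_nbhs (f : X -> Y) x (V : set Y) :
  cont_at f x -> nbhs (f x) V -> \forall z \near x, V (f z).
Proof. by move=> fx /fx. Qed.

Lemma cont_at_open_comp (f : X -> Y) (U : set Y) x :
  cont_at f x -> open U -> U (f x) -> \forall z \near x, U (f z).
Proof. by move=> fx oU Ux; apply: fx; exact: open_nbhs_nbhs. Qed.

End PointwiseContinuity.

Section RealValued.
Variables (R : realType) (X Y : topologicalType).
Implicit Types (f g : X -> R) (x : X).

Lemma cont_atD f g x :
  cont_at f x -> cont_at g x -> cont_at (fun z => f z + g z) x.
Proof. exact: continuousD. Qed.

Lemma cont_atB f g x :
  cont_at f x -> cont_at g x -> cont_at (fun z => f z - g z) x.
Proof. exact: continuousB. Qed.

Lemma cont_atM f g x :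
  cont_at f x -> cont_at g x -> cont_at (fun z => f z * g z) x.
Proof. exact: continuousM. Qed.

Lemma cont_atV f x : f x != 0 -> cont_at f x -> cont_at (fun z => (f z)^-1) x.
Proof. exact: continuousV. Qed.

Lemma cont_at_min f g x :
  cont_at f x -> cont_at g x -> cont_at (fun z => Num.min (f z) (g z)) x.
Proof. exact: continuous_min. Qed.

Lemma cont_at_max f g x :
  cont_at f x -> cont_at g x -> cont_at (fun z => Num.max (f z) (g z)) x.
Proof. exact: continuous_max. Qed.

Lemma near_lt f x c : cont_at f x -> f x < c -> \forall z \near x, f z < c.
Proof.
move=> fx fc; apply: (cont_at_open_comp (U := [set u | u < c]) fx) => //.
Qed.

Lemma near_gt f x c : cont_at f x -> c < f x -> \forall z \near x, c < f z.
Proof.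
move=> fx fc; apply: (cont_at_open_comp (U := [set u | c < u]) fx) => //.
Qed.

(** Pasting along the level [theta = c]: off it one branch agrees with the function near [x], on it
    both branches are continuous with the same value. Each branch has to be continuous only on its
    own side, so it may be built from partial data. *)
Lemma cont_at_if (theta : X -> R) c (f g : X -> Y) x :
  cont_at theta x -> (theta x <= c -> cont_at f x) ->
  (c <= theta x -> cont_at g x) -> (theta x = c -> f x = g x) ->
  cont_at (fun z => if theta z <= c then f z else g z) x.
Proof.
move=> tx fx gx fg; have [tc|tc|tc] := ltgtP (theta x) c.
- apply: cont_at_near (fx (ltW tc)).
  by apply: filterS (near_lt tx tc) => z /ltW ->.
- apply: cont_at_near (gx (ltW tc)).
  by apply: filterS (near_gt tx tc) => z; rewrite leNgt => ->.
- have {}fx : cont_at f x by apply: fx; rewrite tc.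
  have {}gx : cont_at g x by apply: gx; rewrite tc.
  apply: cont_atP => V; rewrite tc lexx => fV.
  have gV : nbhs (g x) V by rewrite -fg.
  apply: filterS (filterI (cont_at_nbhs gx gV) (cont_at_nbhs fx fV)) => z [] *.
  by case: ifP.
Qed.

(* The values of [g] where [f] vanishes do not matter. *)
Lemma cont_at_bounded_mul f g x :
  (forall z, 0 <= f z) -> (forall z, 0 <= g z <= 1) -> cont_at f x ->
  (0 < f x -> cont_at g x) -> cont_at (fun z => f z * g z) x.
Proof.
move=> f0 g01 fx gx; have := f0 x; rewrite le_eqVlt => /predU1P[fx0|fx0].
  rewrite /cont_at /prop_for /continuous_at -fx0 mul0r.
  have fx' : f z @[z --> x] --> 0 by rewrite fx0.
  apply: (squeeze_cvgr _ (cvg_cst 0) fx').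
  apply: nearW => z; have /andP[g0 g1] := g01 z.
  by rewrite mulr_ge0 //= ler_piMr.
by apply: cont_atM => //; exact: gx.
Qed.

End RealValued.

Local Ltac cont_tac := repeat first
  [ assumption | exact: cont_at_cst | exact: cont_at_id
  | apply: cont_at_pair | apply: cont_at_fst | apply: cont_at_snd
  | apply: cont_atB | apply: cont_atD | apply: cont_atM ].

Section UnitInterval.
Variable R : realType.

Definition clamp (x : R) : R := Num.max 0 (Num.min 1 x).

Lemma clamp_itv x : 0 <= clamp x <= 1.
Proof. by rewrite /clamp le_max lexx ge_max ler01 ge_min lexx. Qed.

Lemma clamp0 x : x <= 0 -> clamp x = 0.
Proof.
move=> x0; rewrite /clamp min_r; last exact: le_trans x0 ler01.
exact/max_l.
Qed.

Lemma clamp1 x : 1 <= x -> clamp x = 1.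
Proof. by move=> x1; rewrite /clamp min_l // max_r // ler01. Qed.

Lemma clamp_id x : 0 <= x <= 1 -> clamp x = x.
Proof. by move=> /andP[x0 x1]; rewrite /clamp min_r // max_r. Qed.

Lemma cont_at_clamp (X : topologicalType) (f : X -> R) x :
  cont_at f x -> cont_at (fun z => clamp (f z)) x.
Proof.
move=> fx; apply: cont_at_max; first exact: cont_at_cst.
by apply: cont_at_min => //; exact: cont_at_cst.
Qed.

Lemma clamp_in (x : R) : clamp x \in @unit_interval R.
Proof. by rewrite inE /unit_interval /=; exact: clamp_itv. Qed.

(** Clamping turns every real into a time, so homotopies over [uI R] can be evaluated at computed
    times without a membership proof. *)
Definition to_uI (x : R) : uI R := exist _ (clamp x) (clamp_in x).

Lemma val_to_uI x : set_val (to_uI x) = clamp x.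
Proof. by []. Qed.

Lemma uI_itv (t : uI R) : 0 <= set_val t <= 1.
Proof. by case: t => t /= tI; exact: set_mem tI. Qed.

Lemma uI_inj (s t : uI R) : set_val s = set_val t -> s = t.
Proof. exact: val_inj. Qed.

Lemma to_uIK (t : uI R) : to_uI (set_val t) = t.
Proof. by apply: uI_inj; rewrite val_to_uI clamp_id // uI_itv. Qed.

Lemma to_uI0 : to_uI 0 = uI0 R.
Proof. by apply: uI_inj; rewrite val_to_uI clamp0. Qed.

Lemma to_uI1 : to_uI 1 = uI1 R.
Proof. by apply: uI_inj; rewrite val_to_uI clamp1. Qed.

Lemma cont_at_sub (U V : topologicalType) (S : set V) (f : U -> set_type S) x :
  cont_at (fun z => set_val (f z)) x -> cont_at f x.
Proof.
move=> fx; apply: cont_atP => W [W' [[G oG <-] /= Gfx GW]].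
by apply: filterS (cont_at_open_comp fx oG Gfx) => z; exact: GW.
Qed.

Lemma cont_at_set_val (U V : topologicalType) (S : set V) (f : U -> set_type S)
  x : cont_at f x -> cont_at (fun z => set_val (f z)) x.
Proof. by move=> fx; apply: (cont_at_comp fx); exact: initial_continuous. Qed.

Lemma cont_at_to_uI (X : topologicalType) (f : X -> R) x :
  cont_at f x -> cont_at (fun z => to_uI (f z)) x.
Proof. by move=> fx; apply: cont_at_sub; exact: cont_at_clamp. Qed.

Lemma uI_locally_compact : locally_compact [set: uI R].
Proof.
have cT : compact [set: uI R].
  have -> : [set: uI R] = to_uI @` `[0, 1].
    apply/seteqP; split=> // t _; exists (set_val t); last exact: to_uIK.
    by rewrite /= in_itv /= uI_itv.
  apply: continuous_compact; last exact: segment_compact.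
  by apply: continuous_subspaceT => x; apply: cont_at_to_uI; exact: cont_at_id.
by move=> t _; exists setT; [exact: withinT | split=> //; exact: closedT].
Qed.

Lemma uI_regular : @regular_space (uI R).
Proof. exact: uniform_regular. Qed.

End UnitInterval.

(** * Maps out of a double mapping cylinder *)

Section DoubleMappingCylinder.
Variables (R : realType) (A B C : bspace) (f : C -> A) (g : C -> B).
Notation M := (dmc R f g).

Definition dmc_l (a : A) : M := dmc_pi f g (pre_l R B C a).
Definition dmc_r (b : B) : M := dmc_pi f g (pre_r R A C b).
Definition dmc_c (z : C * uI R) : M := dmc_pi f g (pre_cyl A B z).

Lemma dmc_pi_eq (x y : dmc_pre R A B C) :
  dmc_glue f g x y -> dmc_pi f g x = dmc_pi f g y.
Proof. by move=> xy; apply/eqmodP/asboolP; exact: rst_step. Qed.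

Lemma dmc_c0 c : dmc_c (c, uI0 R) = dmc_l (f c).
Proof. by apply: dmc_pi_eq; exact: glue_l. Qed.

Lemma dmc_c1 c : dmc_c (c, uI1 R) = dmc_r (g c).
Proof. by apply: dmc_pi_eq; exact: glue_r. Qed.

Lemma dmc_c_base c0 t : basept C = Some c0 -> dmc_c (c0, t) = dmc_l (f c0).
Proof. by move=> Cc0; rewrite -dmc_c0; apply: dmc_pi_eq; exact: glue_base. Qed.

Lemma dmc_caseP (P : M -> Prop) :
  (forall a, P (dmc_l a)) -> (forall z, P (dmc_c z)) ->
  (forall b, P (dmc_r b)) -> forall m, P m.
Proof.
move=> Pl Pc Pr m; rewrite -[m]reprK.
by case: (repr m) => -[[|]|] x; [exact: Pr | exact: Pl | exact: Pc].
Qed.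

Section Universal.
Variables (Z : Type) (u : A -> Z) (h : C * uI R -> Z) (v : B -> Z).

Definition dmc_pre_rec (x : dmc_pre R A B C) : Z :=
  match x with
  | existT None z => h z
  | existT (Some false) a => u a
  | existT (Some true) b => v b
  end.

(** Unlike [dmc_induced], this allows varying values along the cylinder. The target is a mere type
    so that it may consist of functions, which gives homotopies on [M]. *)
Definition dmc_rec (m : M) : Z :=
  dmc_pre_rec (repr (m : {eq_quot dmc_equiv R f g})).

Hypothesis hl : forall c, h (c, uI0 R) = u (f c).
Hypothesis hr : forall c, h (c, uI1 R) = v (g c).
Hypothesis hb : forall c t, basept C = Some c -> h (c, t) = u (f c).

Lemma dmc_recE x : dmc_rec (dmc_pi f g x) = dmc_pre_rec x.
Proof.
rewrite /dmc_rec /dmc_pi.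
have /eqmodP/asboolP : repr (\pi_({eq_quot dmc_equiv R f g}) x) = x
  %[mod {eq_quot dmc_equiv R f g}] by rewrite reprK.
move: (repr _) => y; elim=> {x y} //.
- by move=> x y [c|c|c t Cc] /=; rewrite ?hl ?hr ?hb.
- by move=> x y z _ -> _ ->.
Qed.

Lemma dmc_rec_l a : dmc_rec (dmc_l a) = u a.
Proof. exact: dmc_recE. Qed.

Lemma dmc_rec_c z : dmc_rec (dmc_c z) = h z.
Proof. exact: dmc_recE. Qed.

Lemma dmc_rec_r b : dmc_rec (dmc_r b) = v b.
Proof. exact: dmc_recE. Qed.

End Universal.

Lemma dmc_pi_cont_at (X : topologicalType) (F : X -> dmc_pre R A B C) x :
  cont_at F x -> cont_at (fun z => dmc_pi f g (F z)) x.
Proof. by move=> Fx; apply: (cont_at_comp Fx); exact: pi_continuous. Qed.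

Lemma dmc_l_continuous : continuous dmc_l.
Proof.
move=> a; apply: dmc_pi_cont_at.
exact: (@existT_continuous _ (dmc_part R A B C) (Some false)).
Qed.

Lemma dmc_r_continuous : continuous dmc_r.
Proof.
move=> b; apply: dmc_pi_cont_at.
exact: (@existT_continuous _ (dmc_part R A B C) (Some true)).
Qed.

Lemma dmc_c_continuous : continuous dmc_c.
Proof.
move=> z; apply: dmc_pi_cont_at.
exact: (@existT_continuous _ (dmc_part R A B C) None).
Qed.

Section Continuity.
Variable Z : topologicalType.

(** [M] has the final topology for its three parts. The test is restricted to an open [U] because
    the maps built below are continuous only where a control function is positive, or less than
    1. *)
Lemma dmc_cont_at (F : M -> Z) (U : set M) : open U ->
  (forall a, U (dmc_l a) -> cont_at (F \o dmc_l) a) ->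
  (forall z, U (dmc_c z) -> cont_at (F \o dmc_c) z) ->
  (forall b, U (dmc_r b) -> cont_at (F \o dmc_r) b) ->
  forall m, U m -> cont_at F m.
Proof.
move=> oU Fl Fc Fr m Um; apply: cont_atP => V; rewrite nbhsE => -[W [oW Wm] WV].
suff oUW : open (U `&` F @^-1` W).
  by apply: filterS (open_nbhs_nbhs (conj oUW (conj Um Wm))) => z [_ /WV].
have part (X : topologicalType) (j : X -> M) : continuous j ->
    (forall x, U (j x) -> cont_at (F \o j) x) ->
    open (j @^-1` (U `&` F @^-1` W)).
  move=> jc Fj; rewrite openE => x [Ujx Wx]; apply: filterI.
    exact: cont_at_open_comp (jc x) oU Ujx.
  exact: cont_at_open_comp (Fj x Ujx) oW Wx.
apply/sigT_openP => -[[|]|].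
- exact: part dmc_r_continuous Fr.
- exact: part dmc_l_continuous Fl.
- exact: part dmc_c_continuous Fc.
Qed.

Lemma dmc_continuous (F : M -> Z) :
  continuous (F \o dmc_l) -> continuous (F \o dmc_c) ->
  continuous (F \o dmc_r) -> continuous F.
Proof.
move=> Fl Fc Fr m; apply: (@dmc_cont_at F setT openT) => //.
- by move=> a _; exact: Fl.
- by move=> z _; exact: Fc.
- by move=> b _; exact: Fr.
Qed.

End Continuity.

(* The quotient topology is compatible with the product by the locally compact
   interval: a homotopy is a map into the path space. *)
Lemma dmc_homotopy_continuous (Z : topologicalType) (F : M -> uI R -> Z) :
  continuous (fun z : A * uI R => F (dmc_l z.1) z.2) ->
  continuous (fun z : C * uI R * uI R => F (dmc_c z.1) z.2) ->
  continuous (fun z : B * uI R => F (dmc_r z.1) z.2) ->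
  continuous (fun z : M * uI R => F z.1 z.2).
Proof.
move=> /continuous_curry[Fl Fl'] /continuous_curry[Fc Fc'].
move=> /continuous_curry[Fr Fr'].
have -> : (fun z : M * uI R => F z.1 z.2) = uncurry F by apply/funext => -[].
apply: continuous_uncurry_regular; first exact: uI_locally_compact.
- exact: uI_regular.
- exact: (@dmc_continuous {compact-open, uI R -> Z} F).
- by apply: dmc_caseP.
Qed.

End DoubleMappingCylinder.

(** * Local lifts up to homotopy *)

(* Homotopies are parametrised by [R] rather than [uI R], so that times can be
   computed with; only their restriction to [0, 1] is meant. *)
Section LocalLifts.
Variable R : realType.

(** [l] and [K] are total, with arbitrary values where [rho] is not positive; this avoids subspace
    types. *)
Definition lifts_on (Z T W : bspace) (t : T -> W) (d : Z -> W) (rho : Z -> R)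
    (l : Z -> T) (K : Z * R -> W) : Prop :=
  forall z, 0 < rho z ->
    [/\ cont_at l z, forall s, cont_at K (z, s), K (z, 0) = d z,
        K (z, 1) = t (l z) &
        basept Z = Some z ->
          basept T = Some (l z) /\ forall s, K (z, s) = d z].

Definition local_lift (Z T W : bspace) (t : T -> W) (d : Z -> W)
    (rho : Z -> R) : Prop :=
  exists l K, lifts_on t d rho l K.

Definition weight (Z : bspace) (rho : Z -> R) : Prop :=
  continuous rho /\ forall z, 0 <= rho z.

Definition concat (Z W : bspace) (K L : Z * R -> W) (z : Z * R) : W :=
  if z.2 <= 1 / 2 then K (z.1, 2 * z.2) else L (z.1, 2 * z.2 - 1).

Lemma concat_cont_at (Z W : bspace) (K L : Z * R -> W) z s :
  (forall s', cont_at K (z, s')) -> (forall s', cont_at L (z, s')) ->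
  K (z, 1) = L (z, 0) -> cont_at (concat K L) (z, s).
Proof.
move=> Kz Lz KL; apply: cont_at_if => /=.
- by cont_tac.
- by move=> _; apply: (cont_at_comp (g := K)); [cont_tac | exact: Kz].
- by move=> _; apply: (cont_at_comp (g := L)); [cont_tac | exact: Lz].
- move=> ->; have -> : 2 * (1 / 2) = 1 :> R by lra.
  by rewrite subrr.
Qed.

Lemma concat0 (Z W : bspace) (K L : Z * R -> W) z :
  concat K L (z, 0) = K (z, 0).
Proof. by rewrite /concat /= mulr0 divr_ge0. Qed.

Lemma concat1 (Z W : bspace) (K L : Z * R -> W) z :
  concat K L (z, 1) = L (z, 1).
Proof.
rewrite /concat /= ifF; last by apply/negbTE; rewrite -ltNge; lra.
by congr (L (_, _)); lra.
Qed.

(** The second homotopy is run along [l] after the first; they match because [K] ends at [t \o l],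
    where [K'] starts. *)
Lemma lifts_on_comp (Z T T' W : bspace) (t : T -> W) (t' : T' -> W)
    (d : Z -> W) (rho rho' : Z -> R) (sigma : T -> R) l K l' K' :
  lifts_on t d rho l K -> lifts_on t' t sigma l' K' ->
  (forall z, 0 < rho' z -> 0 < rho z /\ 0 < sigma (l z)) ->
  lifts_on t' d rho' (l' \o l) (concat K (fun z => K' (l z.1, z.2))).
Proof.
move=> lK lK' rho'P z /rho'P[rz sz].
have [lz Kz K0 K1 Kb] := lK z rz; have [lz' Kz' K0' K1' Kb'] := lK' _ sz.
split.
- exact: cont_at_comp lz lz'.
- move=> s; apply: concat_cont_at => //=; last by rewrite K0'.
  move=> s'; apply: (cont_at_comp (g := K')); last exact: Kz'.
  apply: cont_at_pair; last by cont_tac.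
  by apply: (cont_at_comp (g := l)); cont_tac.
- by rewrite concat0.
- by rewrite concat1.
- move=> Zz; have [Tl Kc] := Kb Zz; have [Tl' Kc'] := Kb' Tl; split=> //.
  by move=> s; rewrite /concat /=; case: ifP => _; rewrite ?Kc // Kc' -K1 Kc.
Qed.

(* The consequence of well-pointedness that is used: a pointed deformation of X
   collapsing the neighbourhood e < 1 of the base point to it.  Without a base
   point this holds with e = 1. *)
Definition deformable (X : bspace) : Prop :=
  exists (D : X * R -> X) (e : X -> R),
    [/\ continuous D, continuous e, forall x, D (x, 0) = x,
        forall x, 0 <= e x <= 1 &
        (forall x, e x < 1 -> basept X = Some (D (x, 1))) /\
        (forall x, basept X = Some x -> e x = 0 /\ forall s, D (x, s) = x)].

Lemma bprod_basept (X Y : bspace) (z : bprod X Y) :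
  basept (bprod X Y) = Some z <->
  basept X = Some z.1 /\ basept Y = Some z.2.
Proof.
rewrite /=; case: z => x y; case: (basept X) (basept Y) => [x'|] [y'|] /=;
  split=> // -[] //.
- by move=> -> ->.
- by move=> [->] [->].
Qed.

(** * One stage of the construction: separating the two ends of the cylinder *)

Section Wedge.
Variables (A Y T W : bspace) (iota : A -> Y) (t : T -> W).
Notation C := (bprod T A).
Notation f := (prod_map t idfun : C -> bprod W A).
Notation g := (prod_map idfun iota : C -> bprod T Y).
Notation M := (dmc R f g).

(** The step from t_n to t_(n+1), with an arbitrary [t] in place of t_n, so that one stage can be
    studied apart from the recursion. *)
Definition wedge_map : M -> bprod W Y :=
  dmc_induced (prod_map idfun iota : bprod W A -> bprod W Y)
    (prod_map t idfun : bprod T Y -> bprod W Y).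

Lemma wedge_map_l z : wedge_map (dmc_l R f g z) = (z.1, iota z.2).
Proof. by rewrite /wedge_map /dmc_l dmc_inducedE. Qed.

Lemma wedge_map_c z : wedge_map (dmc_c f g z) = (t z.1.1, iota z.1.2).
Proof. by rewrite /wedge_map /dmc_c dmc_inducedE. Qed.

Lemma wedge_map_r z : wedge_map (dmc_r R f g z) = (t z.1, z.2).
Proof. by rewrite /wedge_map /dmc_r dmc_inducedE. Qed.

Section Cover.
Variables (DA : A * R -> A) (eA : A -> R) (DY : Y * R -> Y) (eY : Y -> R).
Hypotheses (DAc : continuous DA) (eAc : continuous eA).
Hypotheses (DA0 : forall a, DA (a, 0) = a) (eA01 : forall a, 0 <= eA a <= 1).
Hypothesis eA_base : forall a, eA a < 1 -> basept A = Some (DA (a, 1)).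
Hypothesis DA_base :
  forall a, basept A = Some a -> eA a = 0 /\ forall s, DA (a, s) = a.
Hypotheses (DYc : continuous DY) (eYc : continuous eY).
Hypotheses (DY0 : forall y, DY (y, 0) = y) (eY01 : forall y, 0 <= eY y <= 1).
Hypothesis eY_base : forall y, eY y < 1 -> basept Y = Some (DY (y, 1)).
Hypothesis DY_base :
  forall y, basept Y = Some y -> eY y = 0 /\ forall s, DY (y, s) = y.
Hypotheses (iotac : continuous iota) (iotab : based iota).
Variables (a1 : A) (w1 : T).
Hypothesis a1_base : forall a, basept A = Some a -> a = a1.
Hypothesis w1_base : forall w, basept T = Some w -> w = w1.

(* On the cylinder over (w, a), [X] and [ramp 2] are the coordinates of a path
   of pairs (how far a is deformed by [DA], how far its image then is by [DY])
   from (0, 0) to (0, 1) through (1, 0) and (1, 1), so that the homotopy [H]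
   below is constant at the end where a lives and is [DY] at the end where only
   its image remains. *)
Let ramp (i : nat) (s : R) : R := clamp (5 * s - i%:R).
Let X (s : R) : R := ramp 0 s - ramp 4 s.

(** On successive fifths of the cylinder over (w, a): zero; rising to [eA a]; equal to [eA a];
    interpolating to [eY] of the image of the deformed point; following [eY] while the deformation
    by [DA] is undone. It descends to the reduced cylinder because [eA] and [eY] vanish at base
    points. *)
Let sigma : M -> R :=
  dmc_rec (fun=> 0)
    (fun z : C * uI R =>
       ramp 1 (set_val z.2) * (1 - ramp 3 (set_val z.2)) * eA z.1.2
       + ramp 3 (set_val z.2) * eY (iota (DA (z.1.2, X (set_val z.2)))))
    (fun z : bprod T Y => eY z.2).

(** The jump at 2/5 disappears where [sigma < 1]: there [eA a < 1], so [DA] has already carried [a]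
    to the base point [a1]. *)
Let alpha : M -> A :=
  dmc_rec (fun z : bprod W A => z.2)
    (fun z : C * uI R =>
       if set_val z.2 <= 2 / 5 then DA (z.1.2, ramp 0 (set_val z.2)) else a1)
    (fun=> a1).

Let H : M -> uI R -> Y :=
  dmc_rec (fun (z : bprod W A) _ => iota z.2)
    (fun (z : C * uI R) u =>
       DY (iota (DA (z.1.2, set_val u * X (set_val z.2))),
           set_val u * ramp 2 (set_val z.2)))
    (fun (z : bprod T Y) u => DY (z.2, set_val u)).

(** The possible jump at the left end is harmless: [sigma] vanishes for cylinder coordinates up to
    1/5, and [beta] serves only where [sigma] is positive. *)
Let beta : M -> T :=
  dmc_rec (fun=> w1)
    (fun z : C * uI R => if set_val z.2 <= 0 then w1 else z.1.1)
    (fun z : bprod T Y => z.1).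

Let iota_base a : basept A = Some a -> basept Y = Some (iota a).
Proof. by move=> Aa; rewrite -iotab Aa. Qed.

Let base_A y : basept Y = Some y -> basept A = Some a1 /\ iota a1 = y.
Proof.
rewrite -iotab; case Aa : (basept A) => [a|] //= -[<-].
by rewrite (a1_base Aa).
Qed.

Let ramp_0 i s : 5 * s <= i%:R -> ramp i s = 0.
Proof. by move=> si; rewrite /ramp clamp0 // subr_le0. Qed.

Let ramp_1 i s : i.+1%:R <= 5 * s -> ramp i s = 1.
Proof. by move=> si; rewrite /ramp clamp1 // lerBrDl natr1. Qed.

Let ramp_cont i (U : topologicalType) (h : U -> R) u :
  cont_at h u -> cont_at (fun v => ramp i (h v)) u.
Proof. by move=> hu; apply: cont_at_clamp; cont_tac. Qed.

Let X_cont (U : topologicalType) (h : U -> R) u :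
  cont_at h u -> cont_at (fun v => X (h v)) u.
Proof. by move=> hu; apply: cont_atB; exact: ramp_cont. Qed.

Let X0 : X 0 = 0.
Proof. by rewrite /X !ramp_0 ?mulr0 ?subrr. Qed.

Let X1 : X 1 = 0.
Proof. by rewrite /X !ramp_1 ?mulr1 ?subrr // ler_nat. Qed.

Let C_base (c : C) : basept C = Some c ->
  [/\ basept T = Some c.1, basept A = Some c.2 & basept Y = Some (iota c.2)].
Proof. by move=> /bprod_basept[Tc Ac]; split=> //; exact: iota_base. Qed.

Let sigmaE : [/\ forall z, sigma (dmc_l R f g z) = 0,
  forall z, sigma (dmc_c f g z) =
    ramp 1 (set_val z.2) * (1 - ramp 3 (set_val z.2)) * eA z.1.2
    + ramp 3 (set_val z.2) * eY (iota (DA (z.1.2, X (set_val z.2)))) &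
  forall z, sigma (dmc_r R f g z) = eY z.2].
Proof.
have s0 (c : C) :
  ramp 1 (set_val (uI0 R)) * (1 - ramp 3 (set_val (uI0 R))) * eA c.2
  + ramp 3 (set_val (uI0 R)) * eY (iota (DA (c.2, X (set_val (uI0 R))))) = 0.
  by rewrite !ramp_0 ?mulr0 // !mul0r addr0.
have s1 (c : C) :
  ramp 1 (set_val (uI1 R)) * (1 - ramp 3 (set_val (uI1 R))) * eA c.2
  + ramp 3 (set_val (uI1 R)) * eY (iota (DA (c.2, X (set_val (uI1 R))))) =
  eY (g c).2.
  rewrite (ramp_1 (i := 3)) ?mulr1 ?ler_nat // subrr mulr0 mul0r add0r mul1r.
  by rewrite [X _]X1 DA0.
have sb (c : C) (u : uI R) : basept C = Some c ->
  ramp 1 (set_val u) * (1 - ramp 3 (set_val u)) * eA c.2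
  + ramp 3 (set_val u) * eY (iota (DA (c.2, X (set_val u)))) = 0.
  move=> /C_base[_ Ac Yc]; have [-> ->] := DA_base Ac.
  by have [-> _] := DY_base Yc; rewrite !mulr0 addr0.
by split=> z; rewrite /sigma ?dmc_rec_l ?dmc_rec_c ?dmc_rec_r.
Qed.

Let alphaE : [/\ forall z, alpha (dmc_l R f g z) = z.2,
  forall z, alpha (dmc_c f g z) =
    (if set_val z.2 <= 2 / 5 then DA (z.1.2, ramp 0 (set_val z.2)) else a1) &
  forall z, alpha (dmc_r R f g z) = a1].
Proof.
have s0 (c : C) : (if set_val (uI0 R) <= 2 / 5
    then DA (c.2, ramp 0 (set_val (uI0 R))) else a1) = (f c).2.
  by rewrite /= divr_ge0 // ramp_0 ?mulr0 // DA0.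
have s1 (c : C) : (if set_val (uI1 R) <= 2 / 5
    then DA (c.2, ramp 0 (set_val (uI1 R))) else a1) = a1.
  rewrite ifF //; apply/negbTE; rewrite -ltNge (_ : set_val (uI1 R) = 1) //.
  by lra.
have sb (c : C) (u : uI R) : basept C = Some c -> (if set_val u <= 2 / 5
    then DA (c.2, ramp 0 (set_val u)) else a1) = (f c).2.
  move=> /C_base[_ Ac _]; have [_ ->] := DA_base Ac.
  by rewrite -(a1_base Ac); case: ifP.
by split=> z; rewrite /alpha ?dmc_rec_l ?dmc_rec_c ?dmc_rec_r.
Qed.

Let HE : [/\ forall z u, H (dmc_l R f g z) u = iota z.2,
  forall z u, H (dmc_c f g z) u =
    DY (iota (DA (z.1.2, set_val u * X (set_val z.2))),
        set_val u * ramp 2 (set_val z.2)) &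
  forall z u, H (dmc_r R f g z) u = DY (z.2, set_val u)].
Proof.
have s0 (c : C) : (fun u : uI R =>
    DY (iota (DA (c.2, set_val u * X (set_val (uI0 R)))),
        set_val u * ramp 2 (set_val (uI0 R)))) = fun=> iota (f c).2.
  by apply/funext => u; rewrite [X _]X0 ramp_0 ?mulr0 // DA0 DY0.
have s1 (c : C) : (fun u : uI R =>
    DY (iota (DA (c.2, set_val u * X (set_val (uI1 R)))),
        set_val u * ramp 2 (set_val (uI1 R)))) =
    fun u => DY ((g c).2, set_val u).
  apply/funext => u; rewrite [X _]X1 mulr0 DA0.
  by rewrite ramp_1 ?mulr1 ?ler_nat.
have sb (c : C) (v : uI R) : basept C = Some c -> (fun u : uI R =>
    DY (iota (DA (c.2, set_val u * X (set_val v))),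
        set_val u * ramp 2 (set_val v))) = fun=> iota (f c).2.
  move=> /C_base[_ Ac Yc]; apply/funext => u; have [_ ->] := DA_base Ac.
  by have [_ ->] := DY_base Yc.
by split=> z u; rewrite /H ?dmc_rec_l ?dmc_rec_c ?dmc_rec_r.
Qed.

Let betaE : [/\ forall z, beta (dmc_l R f g z) = w1,
  forall z, beta (dmc_c f g z) = (if set_val z.2 <= 0 then w1 else z.1.1) &
  forall z, beta (dmc_r R f g z) = z.1].
Proof.
have s0 (c : C) : (if set_val (uI0 R) <= 0 then w1 else c.1) = w1.
  by rewrite lexx.
have s1 (c : C) : (if set_val (uI1 R) <= 0 then w1 else c.1) = (g c).1.
  by rewrite ler10.
have sb (c : C) (u : uI R) : basept C = Some c ->
    (if set_val u <= 0 then w1 else c.1) = w1.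
  by move=> /C_base[Tc _ _]; rewrite (w1_base Tc); case: ifP.
by split=> z; rewrite /beta ?dmc_rec_l ?dmc_rec_c ?dmc_rec_r.
Qed.

Let val2_cont (U : topologicalType) (z : U * uI R) :
  cont_at (fun v : U * uI R => set_val v.2) z.
Proof. by apply: cont_at_set_val; cont_tac. Qed.

Let sigma_cont : continuous sigma.
Proof.
have [sl sc sr] := sigmaE; apply: dmc_continuous => z.
- by apply: cont_at_ext sl _; exact: cont_at_cst.
- apply: cont_at_ext sc _; apply: cont_atD; apply: cont_atM.
  + apply: cont_atM; first exact: ramp_cont.
    by apply: cont_atB; [exact: cont_at_cst | exact: ramp_cont].
  + by apply: (cont_at_comp (g := eA)); [cont_tac | exact: eAc].
  + exact: ramp_cont.
  + apply: (cont_at_comp (g := eY)); last exact: eYc.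
    apply: (cont_at_comp (g := iota)); last exact: iotac.
    apply: (cont_at_comp (g := DA)); last exact: DAc.
    by apply: cont_at_pair; [cont_tac | exact: X_cont].
- by apply: cont_at_ext sr _; apply: (cont_at_comp (g := eY));
    [cont_tac | exact: eYc].
Qed.

Let sigma01 m : 0 <= sigma m <= 1.
Proof.
have [sl sc sr] := sigmaE; move: m; apply: dmc_caseP => z.
- by rewrite sl lexx ler01.
- rewrite sc; set k := ramp 1 _; set k' := ramp 3 _.
  have := eA01 z.1.2; have := eY01 (iota (DA (z.1.2, X (set_val z.2)))).
  set u := eA _; set v := eY _ => /andP[v0 v1] /andP[u0 u1].
  have /andP[k0 k1] : 0 <= k <= 1 by exact: clamp_itv.
  have /andP[k0' k1'] : 0 <= k' <= 1 by exact: clamp_itv.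
  apply/andP; split; first by rewrite addr_ge0 ?mulr_ge0 // subr_ge0.
  have : k' * v <= k' by rewrite ler_piMr.
  have : k * (1 - k') * u <= 1 - k'.
    apply: (@le_trans _ _ (k * (1 - k'))).
      by rewrite ler_piMr // mulr_ge0 // subr_ge0.
    by rewrite ler_piMl // subr_ge0.
  by lra.
- by rewrite sr.
Qed.

Let H_cont : continuous (fun z : M * uI R => H z.1 z.2).
Proof.
have [Hl Hc Hr] := HE; apply: dmc_homotopy_continuous => z.
- apply: (cont_at_ext (fun v => Hl v.1 v.2)).
  by apply: (cont_at_comp (g := iota)); [cont_tac | exact: iotac].
- apply: (cont_at_ext (fun v => Hc v.1 v.2)).
  have val12 : cont_at (fun v : C * uI R * uI R => set_val v.1.2) z.
    by apply: cont_at_set_val; cont_tac.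
  apply: (cont_at_comp (g := DY)); last exact: DYc.
  apply: cont_at_pair; last by apply: cont_atM => //; exact: ramp_cont.
  apply: (cont_at_comp (g := iota)); last exact: iotac.
  apply: (cont_at_comp (g := DA)); last exact: DAc.
  by apply: cont_at_pair; [cont_tac | apply: cont_atM => //; exact: X_cont].
- apply: (cont_at_ext (fun v => Hr v.1 v.2)).
  apply: (cont_at_comp (g := DY)); last exact: DYc.
  by apply: cont_at_pair; [cont_tac | exact: val2_cont].
Qed.

(* Where [sigma < 1] and the cylinder coordinate is at least 2/5, either [a] is
   deformed to the base point by [DA], or its image is by [DY]. *)
Let sigma_lt1 (z : C * uI R) :
  sigma (dmc_c f g z) < 1 -> 2 / 5 <= set_val z.2 ->
  (set_val z.2 <= 3 / 5 -> eA z.1.2 < 1) /\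
  basept Y =
  Some (DY (iota (DA (z.1.2, X (set_val z.2))), ramp 2 (set_val z.2))).
Proof.
have [_ -> _] := sigmaE; set s := set_val z.2; set a := z.1.2 => + s25.
rewrite (ramp_1 (i := 1)); last by lra.
rewrite mul1r.
have base v : eA a < 1 -> basept Y = Some (DY (iota (DA (a, 1)), v)).
  move=> /eA_base /iota_base Yb.
  by have [_ ->] := DY_base Yb.
have [s35 | s35] := leP s (3 / 5).
  rewrite (ramp_0 (i := 3)) ?subr0 ?mul1r ?mul0r ?addr0; last by lra.
  move=> ea; split=> //; have -> : X s = 1; last exact: base.
  by rewrite /X ramp_1 ?ramp_0 ?subr0 //; lra.
move=> sig; split; first by lra.
rewrite (ramp_1 (i := 2)); last by lra.
(* Up to 4/5, [sigma] is a convex combination of a value of [eA] and one of [eY], so one of the two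
   must be less than 1. *)
have [s45 | s45] := leP s (4 / 5).
  have Xs : X s = 1 by rewrite /X ramp_1 ?ramp_0 ?subr0 //; lra.
  move: sig; rewrite Xs; have [ea _ | ea] := ltP (eA a) 1; first exact: base.
  have -> : eA a = 1 by apply/eqP; rewrite eq_le ea andbT; case/andP: (eA01 a).
  move=> sig; apply: eY_base; rewrite ltNge; apply/negP => eY1.
  have eY1' : eY (iota (DA (a, 1))) = 1.
    by apply/eqP; rewrite eq_le eY1 andbT; case/andP: (eY01 (iota (DA (a, 1)))).
  by move: sig; rewrite eY1'; lra.
move: sig; rewrite (ramp_1 (i := 3)); last by lra.
by rewrite subrr mul0r add0r mul1r; exact: eY_base.
Qed.

Let alpha_cont m : sigma m < 1 -> cont_at alpha m.
Proof.
have [al ac ar] := alphaE; move: m.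
apply: (dmc_cont_at (U := [set m | sigma m < 1])) => [|z|z sz|z] /=.
- move/continuousP: sigma_cont => /(_ [set u | u < 1]); apply.
  exact: open_lt.
- by move=> _; apply: cont_at_ext al _; cont_tac.
- apply: cont_at_ext ac _.
  have [s25 | s25] := ltP (set_val z.2) (2 / 5).
    apply: (cont_at_near
      (g := fun z : C * uI R => DA (z.1.2, ramp 0 (set_val z.2)))).
      by apply: filterS (near_lt (@val2_cont _ z) s25) => v /ltW ->.
    apply: (cont_at_comp (g := DA)); last exact: DAc.
    by apply: cont_at_pair; [cont_tac | exact: ramp_cont].
  apply: (cont_at_near (g := fun=> a1)); last exact: cont_at_cst.
  (* Between 2/5 and 3/5, [sigma] is [eA]; as it is less than 1, both branches of [alpha] equal [a1]
     near [z]. *)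
  have [s35 | s35] := ltP (set_val z.2) (3 / 5); last first.
    have s25' : 2 / 5 < set_val z.2 by lra.
    by apply: filterS (near_gt (@val2_cont _ z) s25') => v; rewrite leNgt => ->.
  have ez : eA z.1.2 < 1 by have [+ _] := sigma_lt1 sz s25; apply; exact: ltW.
  have ec : cont_at (fun v : C * uI R => eA v.1.2) z.
    by apply: (cont_at_comp (g := eA)); [cont_tac | exact: eAc].
  have s15 : 1 / 5 < set_val z.2 by lra.
  apply: filterS (filterI (near_lt ec ez) (near_gt (@val2_cont _ z) s15)).
  move=> v [ev sv]; case: ifP => // _; rewrite ramp_1; last by lra.
  exact: a1_base (eA_base ev).
- by move=> _; apply: cont_at_ext ar _; exact: cont_at_cst.
Qed.

Let H1 m : sigma m < 1 -> H m (to_uI 1) = iota (alpha m).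
Proof.
have [al ac ar] := alphaE; have [hl hc hr] := HE; have [sl sc sr] := sigmaE.
have v1 : set_val (to_uI (1 : R)) = 1 by rewrite val_to_uI clamp1.
move: m; apply: dmc_caseP => z sz.
- by rewrite hl al.
- rewrite hc ac v1 !mul1r; case: ifP => [s25 | /negbT].
    by rewrite (ramp_0 (i := 2)) ?DY0 /X ?(ramp_0 (i := 4)) ?subr0 //; lra.
  rewrite -ltNge => /ltW s25; have [_ Yb] := sigma_lt1 sz s25.
  by have [_ ->] := base_A Yb.
- rewrite hr ar v1; rewrite sr in sz.
  by have [_ ->] := base_A (eY_base sz).
Qed.

(** Where [sigma < 1], the homotopy [H] moves the second coordinate to [iota \o alpha]. Where
    [sigma > 0], the point lies off the left end, so its first coordinate comes from [T]. *)
Lemma wedge_cover_explicit :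
  exists (sigma : M -> R) (alpha : M -> A) (G : M * R -> Y) (beta : M -> T),
  [/\ continuous sigma, forall m, 0 <= sigma m <= 1,
      lifts_on iota (fun m => (wedge_map m).2 : Y) (fun m => 1 - sigma m)
        alpha G,
      forall m, 0 < sigma m ->
        cont_at beta m /\ (wedge_map m).1 = t (beta m) &
      forall m, basept M = Some m -> sigma m = 0].
Proof.
have [al ac ar] := alphaE; have [hl hc hr] := HE; have [sl sc sr] := sigmaE.
have [bl bc br] := betaE.
have baseM m : basept M = Some m -> exists2 a, m = dmc_l R f g a &
    basept W = Some a.1 /\ basept A = Some a.2.
  rewrite /=; case Wb : (basept W) => [w|] //=.
  case Ab : (basept A) => [a|] //= -[<-].
  by exists (w, a).
exists sigma, alpha, (fun z => H z.1 (to_uI z.2)), beta; split.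
- exact: sigma_cont.
- exact: sigma01.
- move=> m; rewrite subr_gt0 => sm; split => /=.
  + exact: alpha_cont.
  + move=> s; apply: (cont_at_comp (g := fun z : M * uI R => H z.1 z.2)
      (f := fun z : M * R => (z.1, to_uI z.2))); last exact: H_cont.
    by apply: cont_at_pair; [cont_tac | apply: cont_at_to_uI; cont_tac].
  + have v0 : set_val (to_uI (0 : R)) = 0 by rewrite val_to_uI clamp0.
    move: m {sm}; apply: dmc_caseP => z.
    * by rewrite hl wedge_map_l.
    * by rewrite hc wedge_map_c v0 !mul0r DA0 DY0.
    * by rewrite hr wedge_map_r v0 DY0.
  + exact: H1.
  + move=> /baseM[a -> [_ Aa]]; rewrite al; split=> // s.
    by rewrite hl wedge_map_l.
- move=> m sm; split; last first.
    move: m sm; apply: dmc_caseP => z.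
    + by rewrite sl ltxx.
    + rewrite sc bc wedge_map_c; case: ifP => //= s0.
      by rewrite !ramp_0 ?mul0r ?addr0 ?ltxx // (le_trans _ (ler0n _ _)) //; lra.
    + by rewrite br wedge_map_r.
  move: m sm; apply: (dmc_cont_at (U := [set m | 0 < sigma m])) => [|z|z|z] /=.
  + move/continuousP: sigma_cont => /(_ [set u | 0 < u]); apply.
    exact: open_gt.
  + by rewrite sl ltxx.
  + move=> sz; apply: cont_at_ext bc _.
    apply: (cont_at_near (g := fun z : C * uI R => z.1.1)); last by cont_tac.
    have s0 : 0 < set_val z.2.
      rewrite ltNge; apply/negP => s0; move: sz; rewrite sc.
      by rewrite !ramp_0 ?mul0r ?addr0 ?ltxx // (le_trans _ (ler0n _ _)) //; lra.
    by apply: filterS (near_gt (@val2_cont _ z) s0) => v; rewrite leNgt => ->.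
  + by move=> _; apply: cont_at_ext br _; cont_tac.
- by move=> m /baseM[a -> _]; rewrite sl.
Qed.

End Cover.

Lemma wedge_cover : deformable A -> deformable Y -> is_map iota ->
  inhabited A -> inhabited T ->
  exists (sigma : M -> R) (alpha : M -> A) (G : M * R -> Y) (beta : M -> T),
  [/\ continuous sigma, forall m, 0 <= sigma m <= 1,
      lifts_on iota (fun m => (wedge_map m).2 : Y) (fun m => 1 - sigma m)
        alpha G,
      forall m, 0 < sigma m ->
        cont_at beta m /\ (wedge_map m).1 = t (beta m) &
      forall m, basept M = Some m -> sigma m = 0].
Proof.
move=> [DA [eA [? ? ? ? [? ?]]]] [DY [eY [? ? ? ? [? ?]]]] [? ?] [a] [w].
(* The filler points must be the base points when these exist; otherwise any points of [A] and [T]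
   serve. *)
apply: (@wedge_cover_explicit DA eA DY eY) (odflt a (basept A))
  (odflt w (basept T)) _ _ => //.
- by move=> a' ->.
- by move=> w' ->.
Qed.

End Wedge.
End LocalLifts.

(** * Covers by local lifts *)

Section Stages.
Variable R : realType.

(** * Splitting and joining local lifts over one stage *)

Lemma clamp_gt0 (x : R) : (0 < clamp x) = (0 < x).
Proof. by rewrite /clamp lt_max ltxx lt_min ltr01. Qed.

(** The new weights are positive where [sigma \o l] is above 1/3, respectively below 2/3, within the
    positivity set of [rho]. The factor [rho] makes them continuous everywhere although [sigma \o l]
    is controlled only where [rho > 0]. *)
Lemma local_lift_split (Z A Y T W : bspace) (iota : A -> Y) (t : T -> W)
    (d1 : Z -> W) (d2 : Z -> Y) (rho : Z -> R) :
  deformable R A -> deformable R Y -> is_map iota -> inhabited A ->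
  inhabited T -> weight rho ->
  local_lift (@wedge_map R A Y T W iota t)
    (fun z => (d1 z, d2 z) : bprod W Y) rho ->
  exists rho1 rho2 : Z -> R, [/\ weight rho1, weight rho2,
    forall z, 0 < rho z -> 0 < rho1 z \/ 0 < rho2 z,
    local_lift t d1 rho1 & local_lift iota d2 rho2].
Proof.
move=> dA dY iotam iA iT [rc r0] [l [K lK]].
have [sigma [alpha [G [beta [sc s01 aG bt sb]]]]] :=
  wedge_cover t dA dY iotam iA iT.
pose rho1 z := rho z * clamp (3 * sigma (l z) - 1).
pose rho2 z := rho z * clamp (2 - 3 * sigma (l z)).
have pos z c : 0 < rho z * clamp c -> 0 < rho z /\ 0 < c.
  have := r0 z; rewrite le_eqVlt => /predU1P[<-|rz]; first by rewrite mul0r ltxx.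
  by rewrite pmulr_rgt0 // clamp_gt0.
have slc z : 0 < rho z -> cont_at (fun z => sigma (l z)) z.
  by move=> /lK[lz _ _ _ _]; apply: cont_at_comp lz _; exact: sc.
have rho_clamp (c : Z -> R) : (forall z, 0 < rho z -> cont_at c z) ->
    @weight R Z (fun z => rho z * clamp (c z)).
  move=> cc; split=> z; last by rewrite mulr_ge0 //; case/andP: (clamp_itv (c z)).
  apply: (@cont_at_bounded_mul R Z rho (fun z => clamp (c z))) => //.
  - by move=> z'; exact: clamp_itv.
  - exact: rc.
  - by move=> /cc cz; exact: cont_at_clamp.
exists rho1, rho2; split.
- by apply: rho_clamp => z /slc sz; cont_tac.
- by apply: rho_clamp => z /slc sz; cont_tac.
- move=> z rz; rewrite /rho1 /rho2 !pmulr_rgt0 // !clamp_gt0.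
  by have [s|s] := ltP (1 / 2) (sigma (l z)); [left|right]; lra.
- exists (beta \o l), (fun z => (K z).1) => z /pos[rz sz].
  have {}sz : 0 < sigma (l z) by lra.
  have [lz Kz K0 K1 Kb] := lK z rz; have [bz tb] := bt _ sz; split.
  + exact: cont_at_comp lz bz.
  + by move=> s; apply: cont_at_fst.
  + by rewrite K0.
  + by rewrite K1 tb.
  (* [sigma] vanishes at base points, so none lies in the positivity set of [rho1]. *)
  + by move=> /Kb[/sb s0 _]; rewrite s0 ltxx in sz.
- have lK2 : lifts_on (fun m => (wedge_map m).2 : Y) d2 rho l (fun z => (K z).2).
    move=> z /lK[lz Kz K0 K1 Kb]; split=> //.
    + by move=> s; apply: cont_at_snd.
    + by rewrite K0.
    + by rewrite K1.
    + by move=> /Kb[? Kc]; split=> // s; rewrite Kc.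
  have r2 z : 0 < rho2 z -> 0 < rho z /\ 0 < 1 - sigma (l z).
    by move=> /pos[rz sz]; split=> //; lra.
  by do 2 eexists; exact: lifts_on_comp lK2 aG r2.
Qed.

(** The lower third of the range of [theta] goes to the left end, the middle third across the
    cylinder, the upper third to the right end. Each lift enters only where its weight is positive:
    [theta > 0] gives [rho1 > 0], and [theta < 1] gives [rho2 > 0]. *)
Lemma local_lift_join (Z A Y T W : bspace) (iota : A -> Y) (t : T -> W)
    (d1 : Z -> W) (d2 : Z -> Y) (rho rho1 rho2 : Z -> R) :
  is_map iota -> continuous d1 -> continuous d2 ->
  (forall z, basept Z = Some z ->
    basept W = Some (d1 z) /\ basept Y = Some (d2 z)) ->
  weight rho1 -> weight rho2 ->
  (forall z, 0 < rho z -> 0 < rho1 z \/ 0 < rho2 z) ->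
  local_lift t d1 rho1 -> local_lift iota d2 rho2 ->
  local_lift (@wedge_map R A Y T W iota t)
    (fun z => (d1 z, d2 z) : bprod W Y) rho.
Proof.
move=> [iotac iotab] d1c d2c db [rc1 r1_0] [rc2 r2_0] rcov.
move=> [w [K1 wK]] [a [K2 aK]].
pose C := bprod T A.
pose f : C -> bprod W A := prod_map t idfun.
pose g : C -> bprod T Y := prod_map idfun iota.
pose theta z := rho1 z / (rho1 z + rho2 z).
(* At time 1 the first coordinate must be [t \o w] once [theta >= 1/3], and the second [iota \o a]
   as long as [theta <= 2/3]. The margins from 1/6 to 1/3 and from 2/3 to 5/6 fade each homotopy out
   before its lift loses its meaning. *)
pose p1 (z : Z * R) :=
  if theta z.1 <= 1 / 6 then d1 z.1
  else K1 (z.1, z.2 * clamp (6 * theta z.1 - 1)).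
pose p2 (z : Z * R) :=
  if theta z.1 <= 5 / 6 then K2 (z.1, z.2 * clamp (5 - 6 * theta z.1))
  else d2 z.1.
pose l z : dmc R f g :=
  if theta z <= 1 / 3 then dmc_l R f g (p1 (z, 1), a z)
  else if theta z <= 2 / 3 then dmc_c f g ((w z, a z), to_uI (3 * theta z - 1))
  else dmc_r R f g (w z, p2 (z, 1)).
exists l, (fun z => (p1 z, p2 z)) => z rz.
have r12 : 0 < rho1 z + rho2 z.
  by have := r1_0 z; have := r2_0 z; case: (rcov z rz); lra.
have thetac : cont_at theta z.
  apply: cont_atM; first exact: rc1.
  apply: cont_atV; first by rewrite gt_eqF.
  by apply: cont_atD; [exact: rc1 | exact: rc2].
have th_gt0 : 0 < theta z -> 0 < rho1 z.
  by rewrite /theta pmulr_lgt0 // invr_gt0.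
have th_lt1 : theta z < 1 -> 0 < rho2 z.
  by rewrite /theta ltr_pdivrMr // mul1r ltrDl.
have thetac' s : cont_at (fun z : Z * R => theta z.1) (z, s).
  by apply: (cont_at_comp (g := theta)) => //; cont_tac.
have p1c s : cont_at p1 (z, s).
  have tc := thetac' s; apply: cont_at_if => //= th.
  - by apply: (cont_at_comp (g := d1)); [cont_tac | exact: d1c].
  - have [|_ K1c _ _ _] := wK z; first by apply: th_gt0; lra.
    apply: (cont_at_comp (g := K1)); last exact: K1c.
    apply: cont_at_pair; first by cont_tac.
    by apply: cont_atM; [cont_tac | apply: cont_at_clamp; cont_tac].
  - have [|_ _ K10 _ _] := wK z; first by apply: th_gt0; lra.
    by rewrite th clamp0 ?mulr0 ?K10 //; lra.
have p2c s : cont_at p2 (z, s).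
  have tc := thetac' s; apply: cont_at_if => //= th.
  - have [|_ K2c _ _ _] := aK z; first by apply: th_lt1; lra.
    apply: (cont_at_comp (g := K2)); last exact: K2c.
    apply: cont_at_pair; first by cont_tac.
    by apply: cont_atM; [cont_tac | apply: cont_at_clamp; cont_tac].
  - by apply: (cont_at_comp (g := d2)); [cont_tac | exact: d2c].
  - have [|_ _ K20 _ _] := aK z; first by apply: th_lt1; lra.
    by rewrite th clamp0 ?mulr0 ?K20 //; lra.
have p1t : 1 / 3 <= theta z -> p1 (z, 1) = t (w z).
  move=> th; have [|_ _ _ K11 _] := wK z; first by apply: th_gt0; lra.
  rewrite /p1 /= ifF; last by apply/negbTE; rewrite -ltNge; lra.
  by rewrite clamp1 ?mulr1 //; lra.
have p2i : theta z <= 2 / 3 -> p2 (z, 1) = iota (a z).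
  move=> th; have [|_ _ _ K21 _] := aK z; first by apply: th_lt1; lra.
  rewrite /p2 /= ifT; last by lra.
  by rewrite clamp1 ?mulr1 //; lra.
have wc : 1 / 3 <= theta z -> cont_at w z.
  by move=> th; have [|] := wK z; first by apply: th_gt0; lra.
have ac : theta z <= 2 / 3 -> cont_at a z.
  by move=> th; have [|] := aK z; first by apply: th_lt1; lra.
have p1c1 : cont_at (fun z => p1 (z, 1)) z.
  by apply: (cont_at_comp (g := p1)); [cont_tac | exact: p1c].
have p2c1 : cont_at (fun z => p2 (z, 1)) z.
  by apply: (cont_at_comp (g := p2)); [cont_tac | exact: p2c].
split.
- apply: cont_at_if => // th.
  + apply: (cont_at_comp (g := dmc_l R f g)); last exact: dmc_l_continuous.
    by apply: cont_at_pair => //; apply: ac; lra.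
  + apply: cont_at_if => // th'.
    * apply: (cont_at_comp (g := dmc_c f g)); last exact: dmc_c_continuous.
      apply: cont_at_pair; last by apply: cont_at_to_uI; cont_tac.
      by apply: cont_at_pair; [exact: wc | exact: ac].
    * apply: (cont_at_comp (g := dmc_r R f g)); last exact: dmc_r_continuous.
      by apply: cont_at_pair => //; exact: wc.
    * rewrite th' (_ : 3 * (2 / 3) - 1 = 1); last by lra.
      by rewrite to_uI1 dmc_c1 p2i ?th'.
  + rewrite ifT th; last by lra.
    rewrite (_ : 3 * (1 / 3) - 1 = 0); last by lra.
    by rewrite to_uI0 dmc_c0 p1t ?th.
- by move=> s; apply: cont_at_pair; [exact: p1c | exact: p2c].
- congr (_, _); rewrite /p1 /p2 /= mul0r; have [th|th] //= := leP.
  + by have [|] := wK z; first by apply: th_gt0; lra.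
  + by have [|] := aK z; first by apply: th_lt1; lra.
- rewrite /l; have [th|th] := leP (theta z) (1 / 3).
    by rewrite wedge_map_l /= p2i //; lra.
  have [th'|th'] := leP (theta z) (2 / 3).
    by rewrite wedge_map_c /= p2i // p1t //; lra.
  by rewrite wedge_map_r /= p1t //; lra.
- move=> Zz; have [Wz Yz] := db z Zz.
  have p1b s : p1 (z, s) = d1 z.
    rewrite /p1 /=; have [//|th] := leP.
    by have [|_ _ _ _ /(_ Zz)[]] := wK z; first by apply: th_gt0; lra.
  have p2b s : p2 (z, s) = d2 z.
    rewrite /p2 /=; have [th|//] := leP.
    by have [|_ _ _ _ /(_ Zz)[]] := aK z; first by apply: th_lt1; lra.
  split; last by move=> s; rewrite p1b p2b.
  have [a0 Aa0 ia0] : exists2 a0, basept A = Some a0 & iota a0 = d2 z.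
    by move: Yz; rewrite -iotab; case: (basept A) => //= a0 [<-]; exists a0.
  have -> : basept (dmc R f g) = Some (dmc_l R f g (d1 z, a0)).
    by rewrite /= Wz Aa0.
  have aza : theta z <= 2 / 3 -> a z = a0.
    move=> th; have [|_ _ _ _ /(_ Zz)[]] := aK z; first by apply: th_lt1; lra.
    by rewrite Aa0 => -[].
  have twz : 1 / 3 <= theta z -> basept T = Some (w z) /\ d1 z = t (w z).
    move=> th; have [|_ _ _ K11 /(_ Zz)[Tw K1c]] := wK z.
      by apply: th_gt0; lra.
    by rewrite -K11 K1c.
  (* The segment over the base point is collapsed in the reduced cylinder, so all three formulas for
     [l] give the same point. *)
  congr Some; rewrite /l; have [th|th] := leP (theta z) (1 / 3).
    by rewrite p1b aza //; lra.
  have [Tw d1w] := twz (ltW th).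
  have Cb : basept C = Some (w z, a0) by rewrite /= Tw Aa0.
  have [th'|th'] := leP (theta z) (2 / 3).
    by rewrite aza // dmc_c_base // /f /prod_map /= d1w.
  by rewrite p2b -ia0 -(dmc_c1 R f g (w z, a0)) dmc_c_base // d1w.
Qed.

Lemma bpow_basept (Y : bspace) n :
  basept (bpow Y n) = omap (@Defs.diagonal Y n) (basept Y).
Proof. by elim: n => [|n /= ->]; case: (basept Y). Qed.

Lemma diagonal_continuous (Y : bspace) n : continuous (@Defs.diagonal Y n).
Proof.
elim: n => [|n IHn] y; first exact: cont_at_id.
by apply: cont_at_pair; [exact: IHn | exact: cont_at_id].
Qed.

(** * Covers and lifts of the diagonal *)

Section Cover.
Variables (A Y : bspace) (iota : A -> Y).

(* [n.+1] weights whose positivity sets cover [0 < rho], arranged as a comb to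
   match the recursion defining T^n. *)
Fixpoint cover (n : nat) (rho : Y -> R) : Prop :=
  if n is n'.+1 then
    exists rho1 rho2 : Y -> R, [/\ weight rho1, weight rho2,
      forall y, 0 < rho y -> 0 < rho1 y \/ 0 < rho2 y,
      cover n' rho1 & local_lift iota idfun rho2]
  else local_lift iota idfun rho.

Lemma local_lift_WG_map n (rho : Y -> R) :
  local_lift (@WG_map R A Y iota n.+1) (@Defs.diagonal Y n.+1) rho <->
  local_lift (@wedge_map R _ _ _ _ iota (@WG_map R A Y iota n))
    (fun y => (Defs.diagonal n y, y) : bprod (bpow Y n) Y) rho.
Proof. by rewrite /WG_map /WG_space /=; case: (WG_stage R iota n). Qed.

Lemma WG_space_inhabited n :
  inhabited A -> inhabited Y -> inhabited (WG_space R iota n).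
Proof.
move=> [a] [y]; rewrite /WG_space; case: n => [|n] /=; first by constructor.
case: (WG_stage R iota n) => T t /=; constructor.
exact: (@dmc_l R (bprod (bpow Y n) A) (bprod T Y) (bprod T A) _ _
  (Defs.diagonal n y, a)).
Qed.

Lemma WG_lift_cover n rho :
  deformable R A -> deformable R Y -> is_map iota -> inhabited A ->
  inhabited Y -> weight rho ->
  local_lift (@WG_map R A Y iota n) (@Defs.diagonal Y n) rho -> cover n rho.
Proof.
move=> dA dY iotam iA iY; elim: n rho => [//|n IHn] rho rw.
move=> /local_lift_WG_map /(local_lift_split dA dY iotam iA
  (WG_space_inhabited n iA iY) rw).
move=> [rho1 [rho2 [rw1 rw2 rcov lift1 lift2]]].
by exists rho1, rho2; split=> //; exact: IHn.
Qed.

Lemma cover_WG_lift n rho : is_map iota -> cover n rho ->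
  local_lift (@WG_map R A Y iota n) (@Defs.diagonal Y n) rho.
Proof.
move=> iotam; elim: n rho => [//|n IHn] rho.
move=> [rho1 [rho2 [rw1 rw2 rcov /IHn lift1 lift2]]].
apply/local_lift_WG_map.
apply: local_lift_join iotam _ _ _ rw1 rw2 rcov lift1 lift2.
- exact: diagonal_continuous.
- by move=> y; exact: cont_at_id.
- by move=> y Yy; rewrite bpow_basept Yy.
Qed.

Lemma cover_local_lift n rho y : cover n rho -> 0 < rho y ->
  exists2 rho' : Y -> R, local_lift iota idfun rho' & 0 < rho' y.
Proof.
elim: n rho => [|n IHn] rho; first by exists rho.
move=> [rho1 [rho2 [_ _ rcov cov1 lift2]]] /rcov[/(IHn _ cov1)//|].
by exists rho2.
Qed.

End Cover.

(** The comb pulls back leaf by leaf. How a single local lift pulls back is left as a hypothesis, so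
    that S1, with [f] the identity, and S2 share the induction. *)
Lemma cover_comp (A Y P X : bspace) (iota : A -> Y) (q : P -> X) (f : X -> Y)
    n (rho : Y -> R) :
  continuous f ->
  (forall rho : Y -> R, weight rho -> local_lift iota idfun rho ->
    local_lift q idfun (rho \o f)) ->
  weight rho -> cover iota n rho -> cover q n (rho \o f).
Proof.
move=> fc lift.
have weightf (rho' : Y -> R) : weight rho' -> weight (rho' \o f : X -> R).
  move=> [rc r0]; split=> x; last exact: r0.
  by apply: (cont_at_comp (fc x)); exact: rc.
elim: n rho => [|n IHn] rho rw; first exact: lift.
move=> [rho1 [rho2 [rw1 rw2 rcov cov1 lift2]]].
exists (rho1 \o f), (rho2 \o f); split; try exact: weightf.
- by move=> x /rcov.
- exact: IHn.
- exact: lift.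
Qed.

(** * Global lifts as local lifts of weight 1, and comparison of values of the invariant *)

(** Time is reversed: [H] runs from [t \o l] to [d], whereas [lifts_on] starts at [d]. Stationarity
    at the base point comes from [H] being based at all times. *)
Lemma homotopic_local_lift (Z T W : bspace) (t : T -> W) (d : Z -> W)
    (l : Z -> T) (H : Z * uI R -> W) :
  is_map l -> is_homotopy H (t \o l) d ->
  lifts_on t d (fun=> 1) l (fun z => H (z.1, to_uI (1 - z.2))).
Proof.
move=> [lc lb] [Hc Hb H0 H1] z _; split=> /=.
- exact: lc.
- move=> s; apply: (cont_at_comp (g := H)); last exact: Hc.
  by apply: cont_at_pair; [cont_tac | apply: cont_at_to_uI; cont_tac].
- by rewrite subr0 to_uI1 H1.
- by rewrite subrr to_uI0 H0.
- move=> Zz; split=> [|s]; first by rewrite -lb Zz.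
  have := Hb (uI1 R); rewrite /based Zz /= H1 => Wd.
  by have := Hb (to_uI (1 - s)); rewrite /based Zz -Wd /= => -[].
Qed.

Lemma weight1 (Z : bspace) : @weight R Z (fun=> 1).
Proof. by split=> z; [exact: cont_at_cst | exact: ler01]. Qed.

Section WGLift.
Variables (A Y : bspace) (iota : A -> Y) (n : nat).

Lemma WG_space_basept : is_map iota -> basept Y = None ->
  basept (WG_space R iota n) = None.
Proof.
move=> [_ iotab] Y0.
have A0 : basept A = None by move: iotab; rewrite /based Y0; case: (basept A).
rewrite /WG_space; case: n => [//|m] /=.
by case: (WG_stage R iota m) => T t /=; rewrite A0; case: (basept (bpow Y m)).
Qed.

(** With weight 1 a local lift is global, and its clause on base points says that the map and the
    homotopy are based. *)
Lemma has_WG_liftP : is_map iota ->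
  has_WG_lift R iota n <->
  local_lift (@WG_map R A Y iota n) (@Defs.diagonal Y n) (fun=> 1 : R).
Proof.
move=> iotam; split=> [[l [lm [H Hh]]]|[l [K lK]]].
  by do 2 eexists; exact: homotopic_local_lift lm Hh.
have {}lK z := lK z ltr01.
exists l; split.
  split=> [z|]; first by have [] := lK z.
  rewrite /based; case Yb : (basept Y) => [y|] /=.
    by have [_ _ _ _ /(_ Yb)[]] := lK y.
  by rewrite WG_space_basept.
exists (fun z => K (z.1, 1 - set_val z.2)); split=> [z|u|y|y] /=.
- apply: (cont_at_comp (g := K) (f := fun z : Y * uI R => (z.1, 1 - set_val z.2))).
    apply: cont_at_pair; first by cont_tac.
    apply: cont_atB; first exact: cont_at_cst.
    by apply: cont_at_set_val; cont_tac.
  by have [_ Kc _ _ _] := lK z.1; exact: Kc.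
- rewrite /based bpow_basept; case Yb : (basept Y) => [y|] //=.
  by have [_ _ _ _ /(_ Yb)[_ ->]] := lK y.
- by rewrite (_ : set_val (uI0 R) = 0) // subr0; have [] := lK y.
- by rewrite (_ : set_val (uI1 R) = 1) // subrr; have [] := lK y.
Qed.

End WGLift.

Lemma secatWG_le (A Y P X : bspace) (iota : A -> Y) (q : P -> X) :
  (forall n, has_WG_lift R iota n -> has_WG_lift R q n) ->
  (secatWG R q <= secatWG R iota)%E.
Proof.
move=> lift; rewrite /secatWG.
case: (pselect (exists n, `[< has_WG_lift R iota n >])) => [exi|_]; last exact: leey.
case: ex_minnP => n /asboolP /lift /asboolP qn _.
case: pselect => [exq|[]]; last by exists n.
by rewrite lee_fin lez_nat; case: ex_minnP => m _; exact.
Qed.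

Lemma secatWG_eq0 (A Y : bspace) (iota : A -> Y) :
  secatWG R iota = 0%E <-> has_WG_lift R iota 0.
Proof.
rewrite /secatWG; case: pselect => [ex|nex]; split => //.
- by case: ex_minnP => n /asboolP ln _ [n0]; rewrite n0 in ln.
- move=> /asboolP l0; case: ex_minnP => n _ /(_ _ l0).
  by rewrite leqn0 => /eqP ->.
- by move=> /asboolP l0; case: nex; exists 0.
Qed.

(** * Deformability of well-pointed spaces *)

Lemma object_deformable S (X : bspace) : object R S X -> deformable R X.
Proof.
case: S => -[/= oX _].
  exists fst, (fun=> 1); split=> //; rewrite ?oX.
  - by move=> z; cont_tac.
  - by move=> z; exact: cont_at_cst.
  - by move=> x; rewrite ler01 lexx.
  - by split=> x //; rewrite ltxx.
(* Extend the inclusion of X x {0} over X x I by the inclusion of x0 x I, inside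
   their union [S]: the first coordinate deforms X, and the second one is
   nonzero only at points that have reached x0. *)
case: oX => x0 Xx0 [_ hep].
pose S : set (X * uI R) := [set z | z.2 = uI0 R \/ z.1 = x0].
have inS0 x : (x, uI0 R) \in S by rewrite inE; left.
have inSh (z : [set x0] * uI R) : (set_val z.1, z.2) \in S.
  by rewrite inE; right; exact: (set_valP z.1).
pose f x : set_type S := exist _ (x, uI0 R) (inS0 x).
pose h z : set_type S := exist _ (set_val z.1, z.2) (inSh z).
have fc : continuous f.
  by move=> x; apply: cont_at_sub; apply: cont_at_pair; cont_tac.
have hc : continuous h.
  move=> z; apply: cont_at_sub; apply: cont_at_pair; last by cont_tac.
  by apply: cont_at_set_val; cont_tac.
have [|H [Hc H0 Hh]] := hep _ f h fc hc; first by move=> a; exact: val_inj.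
have Hx0 u : set_val (H (x0, u)) = (x0, u).
  have x0in : x0 \in [set x0] by rewrite inE.
  by rewrite (Hh (exist _ x0 x0in) u).
have vHc : continuous (fun z => set_val (H z)).
  by move=> z; apply: cont_at_set_val; exact: Hc.
exists (fun z => (set_val (H (z.1, to_uI z.2))).1),
  (fun x => 1 - set_val (set_val (H (x, uI1 R))).2); split.
- move=> z; apply: (cont_at_fst (f := fun z : X * R => set_val (H (z.1, to_uI z.2)))).
  apply: (cont_at_comp (g := fun z => set_val (H z))).
    by apply: cont_at_pair; [cont_tac | apply: cont_at_to_uI; cont_tac].
  exact: vHc.
- move=> x; apply: (cont_atB (f := fun=> 1 : R)
    (g := fun x => set_val (set_val (H (x, uI1 R))).2)); first exact: cont_at_cst.
  apply: cont_at_set_val; apply: (cont_at_snd (f := fun x => set_val (H (x, uI1 R)))).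
  apply: (cont_at_comp (g := fun z => set_val (H z))); last exact: vHc.
  by cont_tac.
- by move=> x; rewrite to_uI0 H0.
- move=> x; have := uI_itv (set_val (H (x, uI1 R))).2.
  by set u := set_val _.2; lra.
- split=> x.
    rewrite to_uI1; case: (H (x, uI1 R)) => -[x' u] /= /set_mem[/= ->|/= -> _].
      by rewrite (_ : set_val (uI0 R) = 0) // subr0 ltxx.
    by rewrite Xx0.
  rewrite Xx0 => -[<-]; rewrite Hx0 /= (_ : set_val (uI1 R) = 1) // subrr.
  by split=> // s; rewrite Hx0.
Qed.

(** * Local lifts and homotopy pullbacks *)

(** A tube argument: compactness of [K] makes the neighbourhoods of [u] found at the points of [K]
    uniform. It is stated at one point because the triples [tr] below are controlled only over a
    positivity set. *)
Lemma cont_at_curry (U V W : topologicalType) (F : U -> V -> W) u :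
  (forall v, cont_at (fun z : U * V => F z.1 z.2) (u, v)) ->
  cont_at (F : U -> {compact-open, V -> W}) u.
Proof.
move=> Fu; apply/compact_open_cvgP => K G cK oG FK.
have near_v v : K v -> \forall v' \near v & u' \near u, K v' -> G (F u' v').
  move=> Kv; have [[P Q] [/= uP vQ] PQ] :
      \forall z \near (u, v), G (F z.1 z.2).
    by apply: cont_at_open_comp (Fu v) oG _; apply: FK; exists v.
  by exists (Q, P) => // -[v' u'] [/= Qv Pu] _; exact: (PQ (u', v')).
move/compact_near_coveringP/near_covering_withinP : cK => /(_ U (nbhs u)).
move=> /(_ (fun u' v' => G (F u' v')) _ near_v).
by apply: filterS => u' Fu' _ [v Kv <-]; exact: Fu'.
Qed.

Section Pullback.
Variables (P A X Y : bspace).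
Variables (p : P -> A) (q : P -> X) (iota : A -> Y) (f : X -> Y).
Hypothesis fm : is_map f.

Section Lift.
Variables (rho : Y -> R) (a : Y -> A) (K : Y * R -> Y).
Hypothesis aK : lifts_on iota idfun rho a K.

(** The path is [K] reversed, since paths in [hpb] run from the [A] side to the [X] side. *)
Let tr (x : X) : A * {compact-open, uI R -> Y} * X :=
  (a (f x), (fun u => K (f x, 1 - set_val u)) : {compact-open, uI R -> Y}, x).

Let K_cont x (u : uI R) : 0 < rho (f x) ->
  cont_at (fun z : X * uI R => K (f z.1, 1 - set_val z.2)) (x, u).
Proof.
move=> /aK[_ Kc _ _ _].
apply: (cont_at_comp (g := K)
  (f := fun z : X * uI R => (f z.1, 1 - set_val z.2))); last exact: Kc.
apply: cont_at_pair.
  by apply: (cont_at_comp (g := f)); [cont_tac | exact: fm.1].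
apply: cont_atB; first exact: cont_at_cst.
by apply: cont_at_set_val; cont_tac.
Qed.

Lemma hpb_triple x : 0 < rho (f x) -> hpb_set (R := R) iota f (tr x).
Proof.
move=> rx; have [_ Kc K0 K1 _] := aK rx; split=> /=.
- move=> u; apply: (cont_at_comp (f := fun u => (x, u))
    (g := fun z : X * uI R => K (f z.1, 1 - set_val z.2))); last exact: K_cont.
  by cont_tac.
- by rewrite (_ : set_val (uI0 R) = 0) // subr0 K1.
- by rewrite (_ : set_val (uI1 R) = 1) // subrr K0.
Qed.

(** The lift of [iota] gives a partial map into the standard homotopy pullback, which [g] carries to
    [P]. As the [X] component of [w] is [q], that of the homotopy from [w \o g] to the identity
    relates [q] of the new lift to the identity of [X]. *)
Lemma pullback_lift : continuous rho -> homotopy_pullback R p q iota f ->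
  inhabited P -> local_lift q idfun (rho \o f).
Proof.
move=> rc [H [Hh [w [wE [wm [g [gm _ [L Lh]]]]]]]] [p0].
(* Off the positivity set the value is the arbitrary point [w p0], for which [P] must have a
   point. *)
pose W x : hpb R iota f := insubd (w p0) (tr x).
have WE x : 0 < rho (f x) -> set_val (W x) = tr x.
  by move=> /hpb_triple trx; rewrite set_valE /W insubdK // inE.
exists (g \o W), (fun z => (set_val (L (W z.1, to_uI (1 - z.2)))).2) => x /= rx.
have Wc : cont_at W x.
  apply: cont_at_sub; apply: (cont_at_near (g := tr)).
    have rfc : cont_at (rho \o f) x.
      by apply: (cont_at_comp (fm.1 x)); exact: rc.
    by apply: filterS (near_gt rfc rx) => x'; exact: WE.
  have [ac Kc _ _ _] := aK rx.
  apply: cont_at_pair; last by cont_tac.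
  apply: cont_at_pair; first exact: cont_at_comp (fm.1 x) ac.
  by apply: cont_at_curry => u; exact: K_cont.
have [Lc Lb L0 L1] := Lh; split.
- by apply: cont_at_comp Wc _; exact: gm.1.
- move=> s; apply: cont_at_snd; apply: cont_at_set_val.
  apply: (cont_at_comp (g := L)); last exact: Lc.
  apply: cont_at_pair; last by apply: cont_at_to_uI; cont_tac.
  by apply: (cont_at_comp (g := W)); cont_tac.
- by rewrite subr0 to_uI1 L1 WE.
- by rewrite subrr to_uI0 L0 /= wE.
- move=> Xx; have Yfx : basept Y = Some (f x) by rewrite -fm.2 Xx.
  have [_ _ _ _ /(_ Yfx)[Aa Kx]] := aK rx.
  have hpbW : basept (hpb R iota f) = Some (W x).
    rewrite /= Aa Yfx Xx.
    have -> : (a (f x), fun=> f x, x) = tr x.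
      by congr (_, _, _); apply/funext => u; rewrite Kx.
    by rewrite /W /insubd insubT // inE; exact: hpb_triple.
  split=> [|s]; first by rewrite -gm.2 hpbW.
  have := Lb (to_uI (1 - s)); rewrite /based hpbW /= => -[->].
  by rewrite WE.
Qed.

(** The triple [tr x] is a point of the standard homotopy pullback, and the homotopy inverse of [w]
    sends it into [P]. *)
Lemma pullback_inhabited x : homotopy_pullback R p q iota f ->
  0 < rho (f x) -> inhabited P.
Proof.
move=> [H [_ [w [_ [_ [g _]]]]]] /hpb_triple trx.
have trx' : tr x \in hpb_set (R := R) iota f by rewrite inE.
by constructor; exact: (g (exist _ (tr x) trx')).
Qed.

End Lift.
End Pullback.
End Stages.

(** * The axioms S0, S1 and S2 *)

Theorem proposition58 (R : realType) (T : setting) :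
  (forall (A Y : bspace) (iota : A -> Y),
      object R T A -> object R T Y -> is_map iota ->
      (secatWG R iota = 0%E <->
       exists s : Y -> A, is_map s /\ homotopic R (iota \o s) idfun)) /\
  (forall (A B X : bspace) (kappa : B -> X) (iota : A -> X) (zeta : B -> A),
      object R T A -> object R T B -> object R T X ->
      is_map kappa -> is_map iota -> is_map zeta ->
      homotopic R (iota \o zeta) kappa ->
      (secatWG R iota <= secatWG R kappa)%E) /\
  (forall (P A X Y : bspace)
      (p : P -> A) (q : P -> X) (iota : A -> Y) (f : X -> Y),
      possibly_empty_object R T P ->
      object R T A -> object R T X -> object R T Y ->
      is_map p -> is_map q -> is_map iota -> is_map f ->
      homotopy_pullback R p q iota f ->
      (secatWG R q <= secatWG R iota)%E).
Proof.
(* T^0 is [A] and t_0 is [iota], so a lift at stage 0 is by definition a homotopy section. *)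
split=> [A Y iota _ _ _|]; first exact: secatWG_eq0.
split=> [A B X kappa iota zeta oA oB oX km im zm [H Hh]|].
  apply: secatWG_le => n /(has_WG_liftP R n km) kn; apply/(has_WG_liftP R n im).
  have /= := WG_lift_cover (object_deformable oB) (object_deformable oX) km
    oB.2 oX.2 (weight1 R X) kn.
  move=> /(@cover_comp R _ _ _ _ kappa iota idfun) cov.
  apply: (cover_WG_lift im); apply: cov (weight1 R X) => [x|rho _ [l [K lK]]].
    exact: cont_at_id.
  (* A local lift through [kappa] is continued by [zeta], along the reverse of the homotopy from
     [iota \o zeta] to [kappa]. *)
  do 2 eexists; apply: lifts_on_comp lK (homotopic_local_lift zm Hh) _.
  by move=> x rx; rewrite ltr01.
move=> P A X Y p q iota f oP oA oX oY pm qm im fm pb.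
apply: secatWG_le => n /(has_WG_liftP R n im) ln; apply/(has_WG_liftP R n qm).
have cov := WG_lift_cover (object_deformable oA) (object_deformable oY) im
  oA.2 oY.2 (weight1 R Y) ln.
(* [P] is not assumed non-empty: a point is obtained from a local lift of [iota] around the image of
   some [x]. *)
have iP : inhabited P.
  case: oX => _ [x].
  have [rho [a [K aK]] rx] := cover_local_lift (y := f x) cov ltr01.
  exact: (pullback_inhabited fm aK pb rx).
apply: (cover_WG_lift qm).
refine (cover_comp fm.1 _ (weight1 R Y) cov) => rho [rc _] [a [K aK]].
exact: (pullback_lift fm aK rc pb iP).
Qed.
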